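(* The first-order theory of the structure $\langle\mathbb C;\times\rangle$ is not finitely axiomatizable.
   Context: $\times$ is the usual multiplication of complex numbers and the language is $\{\times\}$. The theory of a structure is finitely axiomatizable if there is a finite set of sentences of the language whose logical consequences are exactly the sentences true in the structure. *)

(* Defs.v *)
From mathcomp Require Import all_boot all_order all_algebra.
From mathcomp Require Import boolp classical_sets cardinality reals.
From mathcomp Require Import complex.

Set Implicit Arguments.
Unset Strict Implicit.
Unset Printing Implicit Defensive.

Local Open Scope classical_set_scope.

(** First-order logic with equality over the language with one binary
    function symbol; variables are named by natural numbers. *)

Inductive term : Type :=
| Var of nat
| Times of term & term.

Inductive formula : Type :=
| Equal of term & term
| Not of formula
| And of formula & formula
| Or of formula & formula
| Imp of formula & formula
| Forall of nat & formula
| Exists of nat & formula.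

Fixpoint term_vars (t : term) : seq nat :=
  match t with
  | Var x => [:: x]
  | Times t1 t2 => term_vars t1 ++ term_vars t2
  end.

Fixpoint free_vars (f : formula) : seq nat :=
  match f with
  | Equal t1 t2 => term_vars t1 ++ term_vars t2
  | Not g => free_vars g
  | And g h | Or g h | Imp g h => free_vars g ++ free_vars h
  | Forall x g | Exists x g => [seq y <- free_vars g | y != x]
  end.

Definition sentence : set formula := [set f | free_vars f = [::]].

Record structure := Structure {
  carrier :> Type;
  times : carrier -> carrier -> carrier;
  nonempty : inhabited carrier
}.

Definition update (T : Type) (e : nat -> T) (x : nat) (a : T) : nat -> T :=
  fun y => if y == x then a else e y.

Fixpoint eval (M : structure) (e : nat -> M) (t : term) : M :=
  match t with
  | Var x => e x
  | Times t1 t2 => times (eval e t1) (eval e t2)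
  end.

Fixpoint sat (M : structure) (e : nat -> M) (f : formula) : Prop :=
  match f with
  | Equal t1 t2 => eval e t1 = eval e t2
  | Not g => ~ sat e g
  | And g h => sat e g /\ sat e h
  | Or g h => sat e g \/ sat e h
  | Imp g h => sat e g -> sat e h
  | Forall x g => forall a : M, sat (update e x a) g
  | Exists x g => exists a : M, sat (update e x a) g
  end.

(** On sentences the choice of assignment is irrelevant, and an assignment
    exists because structures are nonempty. *)
Definition holds (M : structure) (f : formula) : Prop :=
  forall e : nat -> M, sat e f.

Definition theory (M : structure) : set formula :=
  [set f | sentence f /\ holds M f].

Definition consequences (A : set formula) : set formula :=
  [set f | sentence f /\
    forall M : structure, (forall g, A g -> holds M g) -> holds M f].

Definition finitely_axiomatizable (T : set formula) : Prop :=
  exists A : set formula,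
    [/\ finite_set A, A `<=` sentence & consequences A = T].

Definition complex_times (R : realType) : structure :=
  @Structure R[i] (fun z w => (z * w)%R) (inhabits 0%R).

(* Main.v *)
Require Import Defs.
From mathcomp Require Import all_boot all_order all_algebra.
From mathcomp Require Import boolp classical_sets cardinality reals.
From mathcomp Require Import complex generic_quotient ring zify.

Set Implicit Arguments.
Unset Strict Implicit.
Unset Printing Implicit Defensive.
Import Order.TTheory GRing.Theory Num.Theory.
Local Open Scope ring_scope.

(** The theory of the complex numbers under multiplication says that every
    element has [n]-th roots and that there are exactly [n] roots of unity of
    order dividing [n]; no finite part of it can see the roots of unity of
    large prime order. To make this precise, fix a prime [p] and let [mu] be
    the group of all roots of unity of [p]-power order. The quotient of the
    multiplicative monoid of the complex numbers by [mu] has no element of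
    order [p], because a [p]-th root of an element of [mu] is in [mu]. So it
    is not a model of the theory. It remains to see that a given sentence true
    in the complex numbers stays true in this quotient once [p] is large.

    This is an Ehrenfeucht-Fraisse argument ([formula_transferable]). Consider
    quotients of the monoid by two divisible torsion groups [mu1] and [mu2].
    Two assignments match ([matched]) if, up to zeros, they are the classes of
    the [N]-th powers of tuples [e] and [f] of nonzero numbers such that, for
    integer exponents [m] at most [B] in absolute value and roots of unity [z]
    of order at most [B], [e^m z] is in [mu1] exactly when [f^m z] is in
    [mu2]. Keeping the [N]-th roots [e] and [f], and the roots of unity as
    constants, is what makes extending the assignments easy
    ([agree_extend]). Suppose that a new element [a] satisfies a bounded
    relation over the old ones, with exponent [i] at [a]. If [N] was divisible
    by [i], then [a] is a monomial in the old roots times a root of unity, and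
    the same expression on the other side is the answer. If there is no such
    relation, the answer is an element with no bounded relation, and some
    power of two is one ([exists_generic]). The bounds decrease at each
    quantifier, so a sentence needs only finite bounds. At the start, with no
    free variables, matching requires only that [mu1] and [mu2] contain the
    same roots of unity of order at most [B]; the trivial group and the
    [p]-power roots of unity do for [p > B]. *)

(** * Monomials and divisible torsion subgroups *)

Section Roots.
Variable F : numClosedFieldType.
Implicit Types (x y z w : F) (mu : F -> Prop) (e f : nat -> F) (m : nat -> int).

Record divisible_torsion_subgroup mu : Prop := DivisibleTorsionSubgroup {
  subgroup1 : mu 1;
  subgroupM : forall x y, mu x -> mu y -> mu (x * y);
  subgroupV : forall x, mu x -> mu x^-1;
  subgroup_torsion : forall x, mu x -> exists2 n, (0 < n)%N & x ^+ n = 1;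
  subgroup_divisible : forall n x, (0 < n)%N -> mu x ->
    exists2 y, mu y & y ^+ n = x
}.

Definition monomial V e m : F := \prod_(j < V) e j ^ m j.

Definition tuple_power e k : nat -> F := fun j => e j ^+ k.

(** Separates the exponent at a variable that is being reassigned, so that its
    old value disappears from a monomial. *)
Definition drop_exponent (x : nat) m : nat -> int :=
  fun j => if j == x then 0 else m j.

Lemma monomial_neq0 V e m : (forall j, e j != 0) -> monomial V e m != 0.
Proof. by move=> e0; apply/prodf_neq0 => j _; exact: expfz_neq0. Qed.

Lemma tuple_power_neq0 e k :
  (forall j, e j != 0) -> forall j, tuple_power e k j != 0.
Proof. by move=> e0 j; rewrite expf_neq0. Qed.

Lemma monomialD V e m1 m2 : (forall j, e j != 0) ->
  monomial V e (fun j => m1 j + m2 j) = monomial V e m1 * monomial V e m2.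
Proof.
by move=> e0; rewrite -big_split; apply: eq_bigr => j _ /=; rewrite expfzDr.
Qed.

Lemma monomialX V e m (k : int) :
  monomial V e (fun j => m j * k) = monomial V e m ^ k.
Proof.
rewrite /monomial; apply: (big_ind2 (fun a b => a = b ^ k)).
- by rewrite exp1rz.
- by move=> a b c d -> ->; rewrite expfzMl.
- by move=> j _; rewrite exprz_exp.
Qed.

Lemma monomial_tuple_power V e k m :
  monomial V (tuple_power e k) m = monomial V e (fun j => m j * k%:Z).
Proof.
apply: eq_bigr => j _; rewrite /tuple_power exprnP exprz_exp.
by rewrite mulrC.
Qed.

Lemma monomial_update V e (x : nat) a m : (x < V)%N ->
  monomial V (update e x a) m = monomial V e (drop_exponent x m) * a ^ m x.
Proof.
move=> xV; rewrite /monomial (bigD1 (Ordinal xV)) //=.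
rewrite [X in _ = X * _](bigD1 (Ordinal xV)) //=.
rewrite /update /drop_exponent eqxx expr0z mul1r mulrC; congr (_ * _).
apply: eq_bigr => j; rewrite -val_eqE /= => /negbTE jx.
by rewrite jx.
Qed.

Lemma drop_exponent_bound K (x : nat) m :
  (forall j, `|m j| <= K)%N -> forall j, (`|drop_exponent x m j| <= K)%N.
Proof. by move=> mK j; rewrite /drop_exponent; case: ifP. Qed.

Lemma subgroupX mu (muP : divisible_torsion_subgroup mu) x n :
  mu x -> mu (x ^+ n).
Proof.
move=> mux; elim: n => [|n IH]; first exact: subgroup1.
by rewrite exprS; exact: subgroupM.
Qed.

Lemma subgroupXz mu (muP : divisible_torsion_subgroup mu) x (i : int) :
  mu x -> mu (x ^ i).
Proof.
move=> mux; case: i => n; first exact: subgroupX.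
by apply: subgroupV => //; exact: subgroupX.
Qed.

Lemma subgroup_neq0 mu (muP : divisible_torsion_subgroup mu) x :
  mu x -> x != 0.
Proof.
case/(subgroup_torsion muP) => n n0 xn; apply/eqP => x0.
by move/eqP: xn; rewrite x0 expr0n -[(n == 0)%N]negbK -lt0n n0 eq_sym oner_eq0.
Qed.

Lemma subgroup_divisible_int mu (muP : divisible_torsion_subgroup mu)
  (i : int) x :
  i != 0 -> mu x -> exists2 y, mu y & y ^ i = x.
Proof.
case: i => n n0 mux; first by apply: (subgroup_divisible muP) => //; rewrite lt0n.
have [y muy yx] := subgroup_divisible muP (ltn0Sn n) mux.
by exists y^-1; [exact: subgroupV | rewrite /exprz exprVn yx invrK].
Qed.

(** If every power of two satisfied a relation, two of them would satisfy the
    same one, there being finitely many; dividing, a nontrivial power of two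
    would be in the torsion group [mu]. *)
Lemma exists_generic mu (muP : divisible_torsion_subgroup mu) V e K :
  (forall j, e j != 0) ->
  exists2 c, c != 0 & forall m (i : int), (forall j, `|m j| <= K)%N ->
    (`|i| <= K)%N -> i != 0 -> ~ mu (monomial V e m * c ^ i).
Proof.
move=> e0.
apply: contrapT => /forall2NP no_generic.
pose T := ({ffun 'I_V -> 'I_(K + K).+1} * 'I_(K + K).+1)%type.
(* Integers between -K and K are coded by ordinals, shifted by K. *)
pose decode (k : 'I_(K + K).+1) : int := k%:Z - K%:Z.
have codeP (k : int) : (`|k| <= K)%N -> exists c, decode c = k.
  move=> kK; exists (inord (absz (k + K%:Z))).
  by rewrite /decode inordK; lia.
have rel n : exists t : T, decode t.2 != 0 /\
    mu ((\prod_(j < V) e j ^ decode (t.1 j)) * (2 ^+ n) ^ decode t.2).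
  have [/eqP|] := no_generic (2 ^+ n); first by rewrite expf_eq0 pnatr_eq0 andbF.
  case/existsNP => m; case/existsNP => i.
  case/not_implyP => mK; case/not_implyP => iK; case/not_implyP => i0 /contrapT mui.
  have [i' di] := codeP i iK.
  have [m' dm] : exists m' : {ffun 'I_V -> 'I_(K + K).+1},
      forall j : 'I_V, decode (m' j) = m j.
    exists [ffun j : 'I_V => projT1 (cid (codeP (m j) (mK j)))] => j.
    by rewrite ffunE; case: cid.
  exists (m', i'); rewrite /= di; split => //.
  by under eq_bigr do rewrite dm.
have [t tP] := choice rel.
have /injectivePn [a [b ab tab]] :
    ~~ injectiveb (fun n : 'I_(#|{: T}|).+1 => t n).
  apply/negP => /injectiveP /leq_card; rewrite card_ord.
  by rewrite ltnn.
have [i0 mua] := tP a; have [_ mub] := tP b; rewrite -tab in mub.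
have := subgroupM muP mua (subgroupV muP mub).
set P := \prod_(j < V) _; set i := decode _ in i0 *.
have P0 : P != 0 by apply/prodf_neq0 => j _; exact: expfz_neq0.
have -> : P * (2 ^+ a) ^ i / (P * (2 ^+ b) ^ i) = (2 ^+ a / 2 ^+ b) ^ i.
  rewrite expfzMl invfM mulrACA divff // mul1r; congr (_ * _).
  by rewrite -expfV.
case/(subgroup_torsion muP) => k k0.
have -> (z : F) : (z ^ i) ^+ k = z ^ (i * k%:Z) by rewrite exprnP exprz_exp.
have ik0 : i * k%:Z != 0 by rewrite mulf_neq0 // -lt0n.
have absE (z : F) (l : int) : z ^ l = 1 -> z ^+ `|l| = 1.
  by case: l => // n /eqP; rewrite /exprz /= invr_eq1 => /eqP.
move/absE; set l := `|_|%N; have l0 : (0 < l)%N by rewrite absz_gt0.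
rewrite expr_div_n => /divr1_eq.
rewrite -!exprM => /(ieexprIn (ltr0n F 2)) abl.
case/eqP: ab; apply/val_inj/eqP; rewrite -(eqn_pmul2r l0).
by apply/eqP/abl; rewrite (eqr_nat F 2 1).
Qed.

(** * Tuples with the same bounded relations *)

(** The bounded roots of unity [z] serve as constants: without them, the
    agreement of two tuples would not determine which root of a monomial
    corresponds to which. *)
Definition agree mu1 mu2 V B e f := forall m z d, (forall j, `|m j| <= B)%N ->
  (0 < d <= B)%N -> z ^+ d = 1 ->
  mu1 (monomial V e m * z) <-> mu2 (monomial V f m * z).

Lemma agreeC mu1 mu2 V B e f : agree mu1 mu2 V B e f -> agree mu2 mu1 V B f e.
Proof. by move=> ag m z d mB dB zd; apply: iff_sym; exact: (ag m z d). Qed.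

Lemma agree_tuple_power mu1 mu2 V B k B' e f : (0 < k)%N -> (B * k <= B')%N ->
  agree mu1 mu2 V B' e f ->
  agree mu1 mu2 V B (tuple_power e k) (tuple_power f k).
Proof.
move=> k0 kB ag m z d mB dB zd; rewrite !monomial_tuple_power.
apply: (ag _ _ d) => // [j|].
  by rewrite abszM (leq_trans _ kB) // leq_mul.
case/andP: dB => -> dB /=; apply: leq_trans dB (leq_trans _ kB).
by rewrite leq_pmulr.
Qed.

(** Solving a relation for the new element and substituting into another gives
    exponents up to [B + B * B] over the old elements, and multiplies the
    orders of roots of unity with an exponent, up to [B * B * B]. The factorial
    turns exponents over the old elements into exponents over their roots. *)
Definition extension_bound B := (B + B * B + B * B * B) * B`!.

(** The tuples [e] and [f] are roots of order [B`!] of the tuples being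
    extended. In a relation that involves the new element [a], its exponent
    divides [B`!], so [a] equals, up to a root of unity, a monomial in [e]. The
    factor [w] in [mu1] is the freedom to change the representative of the
    class of [a], which turns a relation modulo [mu1] into an equation. *)
Lemma agree_extend mu1 mu2 V B e f (x : nat) a :
  divisible_torsion_subgroup mu1 -> divisible_torsion_subgroup mu2 ->
  (0 < B)%N -> (x < V)%N -> (forall j, e j != 0) -> (forall j, f j != 0) ->
  agree mu1 mu2 V (extension_bound B) e f -> a != 0 ->
  exists w c, [/\ mu1 w, c != 0 &
    agree mu1 mu2 V B (update (tuple_power e B`!) x (a * w))
                      (update (tuple_power f B`!) x c)].
Proof.
move=> mu1P mu2P B0 xV e0 f0 ag a0; set L := B`!.
have L0 : (0 < L)%N := fact_gt0 B.
have BL : (B <= L)%N.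
   by apply: dvdn_leq => //; apply: dvdn_fact; rewrite B0 leqnn.
pose E := tuple_power e L; pose G := tuple_power f L.
have [[m [z [d [mB dB zd mx0 mumz]]]]|no_rel] := pselect (exists m z d,
    [/\ (forall j, `|m j| <= B)%N, (0 < d <= B)%N, z ^+ d = 1, m x != 0 &
        mu1 (monomial V E (drop_exponent x m) * a ^ m x * z)]).
  have [v muv vE] := subgroup_divisible_int mu1P mx0 mumz.
  have [q qE] : exists q : int, L%:Z = q * m x.
    apply/dvdzP; rewrite /dvdz /=; apply: dvdn_fact; rewrite absz_gt0 mx0 /=; exact: mB.
  have qL : (`|q| <= L)%N.
    by rewrite -[L]/(`|L%:Z|%N) qE abszM leq_pmulr // absz_gt0.
  (* Solving the relation gives a w = e^r t, with t a root of unity. *)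
  pose r j := - (q * drop_exponent x m j).
  pose t := a * v^-1 / monomial V e r.
  have v0 := subgroup_neq0 mu1P muv.
  have z0 : z != 0.
    case/andP: dB => d0 _; apply/eqP => zE; move/eqP: zd.
    by rewrite zE expr0n -[(d == 0)%N]negbK -lt0n d0 eq_sym oner_eq0.
  have tz : t ^ m x = z^-1.
    rewrite /t !expfzMl -!expfV vE -monomialX.
    rewrite monomial_tuple_power.
    have -> : monomial V e (fun j => r j * m x) =
              (monomial V e (fun j => drop_exponent x m j * L%:Z))^-1.
      rewrite -exprN1 -monomialX; apply: eq_bigr => j _; congr (_ ^ _).
      by rewrite qE /r; ring.
    have := monomial_neq0 V (fun j => drop_exponent x m j * L%:Z) e0.
    have : a ^ m x != 0 by exact: expfz_neq0.
    by move: (a ^ _) (monomial _ _ _) => A M A0 M0; field; rewrite z0 A0 M0.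
  have td : t ^+ (`|m x| * d) = 1.
    rewrite exprM; case: (m x) tz => n /= tz.
      by rewrite -exprnP in tz; rewrite tz exprVn zd invr1.
    move/(congr1 GRing.inv): tz; rewrite /exprz !invrK => ->.
    by rewrite zd.
  have t0 : t != 0.
    apply: mulf_neq0; first by rewrite mulf_neq0 // invr_eq0.
    by rewrite invr_eq0 monomial_neq0.
  (* The same computation serves on both sides, and reduces a relation over the
     extended tuple to one over the tuple of roots. *)
  have extE g (g0 : forall j, g j != 0) m' z' :
      monomial V (update (tuple_power g L) x (monomial V g r * t)) m' * z' =
      monomial V g (fun j => drop_exponent x m' j * L%:Z + r j * m' x) *
      (t ^ m' x * z').
    rewrite monomial_update // monomial_tuple_power monomialD // (monomialX V g r).
    by rewrite expfzMl !mulrA.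
  exists v^-1, (monomial V f r * t); split.
  - exact: subgroupV.
  - by rewrite mulf_neq0 // monomial_neq0.
  - have -> : a * v^-1 = monomial V e r * t.
      by rewrite /t mulrCA divff ?mulr1 // monomial_neq0.
    move=> m' z' d' m'B d'B z'd; rewrite !extE //.
    apply: (ag _ _ (`|m x| * d * d')%N).
    + move=> j.
      have h1 : (`|(drop_exponent x m' j * L%:Z)%R| <= B * L)%N.
        by rewrite abszM leq_mul ?drop_exponent_bound //.
      have h2 : (`|(r j * m' x)%R| <= L * B * B)%N.
        by rewrite /r mulNr abszN !abszM !leq_mul ?drop_exponent_bound //.
      rewrite -!(mulnC L) in h1 h2 *.
      have BB : (B <= B * B)%N by rewrite leq_pmulr.
      have BBB : (B <= B * B * B)%N by rewrite leq_pmull ?muln_gt0 ?B0.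
      rewrite /extension_bound -/L; nia.
    + case/andP: dB => d0 dB; case/andP: d'B => d'0 d'B.
      rewrite !muln_gt0 absz_gt0 mx0 d0 d'0 /=.
      apply: (@leq_trans (B * B * B)%N); first by rewrite !leq_mul.
      by rewrite /extension_bound -/L; nia.
    + have tX (i : int) k : t ^+ k = 1 -> (t ^ i) ^+ k = 1.
        rewrite [(t ^ i) ^+ k]exprnP exprz_exp mulrC -exprz_exp -exprnP => ->.
        exact: exp1rz.
      rewrite exprMn exprM tX // expr1n mul1r.
      by rewrite mulnC exprM z'd expr1n.
have [c c0 gen] := exists_generic mu2P V (extension_bound B) f0.
exists 1, c; split=> //; first exact: subgroup1.
rewrite mulr1 => m z d mB dB zd; rewrite !monomial_update //.
have [mx0|mx0] := eqVneq (m x) 0.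
  rewrite mx0 !expr0z !mulr1 !monomial_tuple_power.
  apply: (ag _ _ d) => //.
    move=> j; rewrite abszM; apply: (@leq_trans (B * L)%N).
      by rewrite leq_mul ?drop_exponent_bound //.
    by rewrite leq_mul2r; apply/orP; right; nia.
  by case/andP: dB => -> /leq_trans -> //; rewrite /extension_bound; nia.
split=> [rel|rel].
  by case: no_rel; exists m, z, d.
have /andP[d0 dB'] := dB.
(* The power d removes z, which exists_generic does not allow for. *)
have := subgroupX mu2P d rel.
rewrite exprMn zd mulr1 exprMn exprnP -monomialX exprnP exprz_exp.
rewrite monomial_tuple_power => /gen; case.
- move=> j; rewrite !abszM.
  apply: (@leq_trans (B * B * L)%N).
    by rewrite !leq_mul ?drop_exponent_bound //.
  by rewrite /extension_bound; nia.
- rewrite abszM; apply: (@leq_trans (B * B)%N); first by rewrite leq_mul.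
  by rewrite /extension_bound; nia.
- by rewrite mulf_neq0 // -lt0n.
Qed.

(** * Back-and-forth between quotients of the monoid *)

Record presents_quotient mu (M : structure) (pi : F -> M) : Prop :=
    PresentsQuotient {
  presents_surj : forall a, exists x, a = pi x;
  presentsM : forall x y, pi (x * y) = times (pi x) (pi y);
  presents_eq : forall x y, pi x = pi y <-> exists2 w, mu w & x = w * y
}.

Lemma presents_eq0 mu (M : structure) (pi : F -> M) x :
  presents_quotient mu pi -> pi x = pi 0 -> x = 0.
Proof. by move=> piP /(presents_eq piP)[w _ ->]; rewrite mulr0. Qed.

Lemma presents_eq_div mu (M : structure) (pi : F -> M) x y :
  presents_quotient mu pi -> y != 0 ->
  pi x = pi y <-> mu (x / y).
Proof.
move=> piP y0; split=> [/(presents_eq piP)[w muw ->]|muxy].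
  by rewrite mulfK.
by apply/(presents_eq piP); exists (x / y); rewrite ?divfK.
Qed.

(** [S] lists the variables whose values are compared; it shrinks to the empty
    list for a sentence, while [e] and [f] are total tuples of units. Zero has
    no place in a monomial and is matched separately. *)
Definition matched mu1 mu2 (M1 M2 : structure) (pi1 : F -> M1) (pi2 : F -> M2)
    V (S : seq nat) N B (h1 : nat -> M1) (h2 : nat -> M2) : Prop :=
  exists e f, [/\ forall j, e j != 0, forall j, f j != 0,
    agree mu1 mu2 V B e f &
    forall j, j \in S -> h1 j = pi1 0 /\ h2 j = pi2 0 \/
                         h1 j = pi1 (e j ^+ N) /\ h2 j = pi2 (f j ^+ N)].

Lemma matchedC mu1 mu2 (M1 M2 : structure) (pi1 : F -> M1) (pi2 : F -> M2)
    V S N B h1 h2 :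
  matched mu1 mu2 pi1 pi2 V S N B h1 h2 -> matched mu2 mu1 pi2 pi1 V S N B h2 h1.
Proof.
case=> e [f [e0 f0 ag hP]]; exists f, e; split=> //; first exact: agreeC.
move=> j /hP.
by case=> -[-> ->]; [left | right].
Qed.

Lemma matched_weaken mu1 mu2 (M1 M2 : structure) (pi1 : F -> M1) (pi2 : F -> M2)
    V S S' N k B B' h1 h2 :
  (0 < k)%N -> (B * k <= B')%N -> {subset S <= S'} ->
  matched mu1 mu2 pi1 pi2 V S' (k * N) B' h1 h2 ->
  matched mu1 mu2 pi1 pi2 V S N B h1 h2.
Proof.
move=> k0 kB SS' [e [f [e0 f0 ag hP]]].
exists (tuple_power e k), (tuple_power f k); split.
- exact: tuple_power_neq0.
- exact: tuple_power_neq0.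
- exact: agree_tuple_power ag.
- by move=> j /SS' /hP; rewrite /tuple_power -!exprM.
Qed.

(** [N]-th roots of the new elements are added to the tuples, so that the
    exponent drops from [B`! * N] to [N]. *)
Lemma matched_extend mu1 mu2 (M1 M2 : structure) (pi1 : F -> M1) (pi2 : F -> M2)
    V S S' N B h1 h2 (x : nat) a :
  divisible_torsion_subgroup mu1 -> divisible_torsion_subgroup mu2 ->
  presents_quotient mu1 pi1 -> presents_quotient mu2 pi2 ->
  (0 < N)%N -> (0 < B)%N -> (x < V)%N ->
  (forall j, j \in S -> j != x -> j \in S') ->
  matched mu1 mu2 pi1 pi2 V S' (B`! * N) (extension_bound B) h1 h2 ->
  exists b, matched mu1 mu2 pi1 pi2 V S N B (update h1 x a) (update h2 x b).
Proof.
move=> mu1P mu2P pi1P pi2P N0 B0 xV SS' [e [f [e0 f0 ag hP]]].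
have [a0 ->] := presents_surj pi1P a.
have [->|a0_neq0] := eqVneq a0 0.
  exists (pi2 0), (tuple_power e B`!), (tuple_power f B`!); split.
  - exact: tuple_power_neq0.
  - exact: tuple_power_neq0.
  - apply: agree_tuple_power ag; first exact: fact_gt0.
    by rewrite /extension_bound leq_mul2r; apply/orP; right; nia.
  - move=> j jS; rewrite /update; case: eqVneq => [_|jx]; first by left.
    by rewrite /tuple_power -!exprM; apply: hP; exact: SS'.
pose r := N.-root a0.
have rN : r ^+ N = a0 by exact: rootCK.
have r0 : r != 0 by rewrite rootC_eq0.
have [w [c [muw c0 ag']]] := agree_extend mu1P mu2P B0 xV e0 f0 ag r0.
exists (pi2 (c ^+ N)), (update (tuple_power e B`!) x (r * w)),
  (update (tuple_power f B`!) x c); split=> //.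
- move=> j; rewrite /update; case: ifP => _; last exact: tuple_power_neq0.
  by rewrite mulf_neq0 // (subgroup_neq0 mu1P).
- move=> j; rewrite /update; case: ifP => _ //; exact: tuple_power_neq0.
- move=> j jS; rewrite /update; case: eqVneq => [_|jx].
    right; split=> //; apply/esym/(presents_eq pi1P).
    exists (w ^+ N); first exact: subgroupX.
    by rewrite exprMn rN mulrC.
  by rewrite /tuple_power -!exprM; apply: hP; exact: SS'.
Qed.

Definition multiplicity (N : nat) (t : term) : nat -> int :=
  fun j => (count_mem j (term_vars t) * N)%:Z.

Lemma multiplicity_bound N t j :
  (`|multiplicity N t j| <= size (term_vars t) * N)%N.
Proof. by rewrite /multiplicity leq_mul // count_size. Qed.

Lemma monomial_multiplicity_var V e N (x : nat) : (x < V)%N ->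
  monomial V e (multiplicity N (Var x)) = e x ^+ N.
Proof.
move=> xV; rewrite /monomial (bigD1 (Ordinal xV)) //= big1.
  by rewrite /multiplicity /= eqxx mul1n mulr1.
move=> j; rewrite -val_eqE /multiplicity /= eq_sym => /negbTE ->.
by rewrite mul0n.
Qed.

Lemma monomial_multiplicity_times V e N t1 t2 : (forall j, e j != 0) ->
  monomial V e (multiplicity N (Times t1 t2)) =
  monomial V e (multiplicity N t1) * monomial V e (multiplicity N t2).
Proof.
move=> e0; rewrite -monomialD //; apply: eq_bigr => j _; congr (_ ^ _).
by rewrite /multiplicity /= count_cat mulnDl.
Qed.

Lemma eval_matched mu1 mu2 (M1 M2 : structure) (pi1 : F -> M1) (pi2 : F -> M2)
    V N e f h1 h2 t :
  presents_quotient mu1 pi1 -> presents_quotient mu2 pi2 ->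
  (forall j, e j != 0) -> (forall j, f j != 0) ->
  (forall j, j \in term_vars t -> (j < V)%N) ->
  (forall j, j \in term_vars t -> h1 j = pi1 0 /\ h2 j = pi2 0 \/
                       h1 j = pi1 (e j ^+ N) /\ h2 j = pi2 (f j ^+ N)) ->
  eval h1 t = pi1 0 /\ eval h2 t = pi2 0 \/
  eval h1 t = pi1 (monomial V e (multiplicity N t)) /\
  eval h2 t = pi2 (monomial V f (multiplicity N t)).
Proof.
move=> pi1P pi2P e0 f0; elim: t => [x|t1 IH1 t2 IH2] tV hP /=.
  have xx : x \in term_vars (Var x) by rewrite mem_head.
  by rewrite !monomial_multiplicity_var; [exact: hP | exact: tV | exact: tV].
have l j : j \in term_vars t1 -> j \in term_vars (Times t1 t2).
  by rewrite mem_cat => ->.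
have r j : j \in term_vars t2 -> j \in term_vars (Times t1 t2).
  by rewrite mem_cat orbC => ->.
have [[-> ->]|[-> ->]] := IH1 (fun j jt => tV j (l j jt)) (fun j jt => hP j (l j jt));
have [[-> ->]|[-> ->]] := IH2 (fun j jt => tV j (r j jt)) (fun j jt => hP j (r j jt));
rewrite -(presentsM pi1P) -(presentsM pi2P) ?mulr0 ?mul0r; try by left.
by right; rewrite !monomial_multiplicity_times.
Qed.

Definition transfers V (g : formula) N B : Prop :=
  forall mu1 mu2 (M1 M2 : structure) (pi1 : F -> M1) (pi2 : F -> M2) h1 h2,
  divisible_torsion_subgroup mu1 -> divisible_torsion_subgroup mu2 ->
  presents_quotient mu1 pi1 -> presents_quotient mu2 pi2 ->
  matched mu1 mu2 pi1 pi2 V (free_vars g) N B h1 h2 -> sat h1 g <-> sat h2 g.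

Lemma transfers_weaken V g N k B B' : (0 < k)%N -> (B * k <= B')%N ->
  transfers V g N B ->
  forall mu1 mu2 (M1 M2 : structure) (pi1 : F -> M1) (pi2 : F -> M2) S h1 h2,
  divisible_torsion_subgroup mu1 -> divisible_torsion_subgroup mu2 ->
  presents_quotient mu1 pi1 -> presents_quotient mu2 pi2 ->
  {subset free_vars g <= S} ->
  matched mu1 mu2 pi1 pi2 V S (k * N) B' h1 h2 -> sat h1 g <-> sat h2 g.
Proof.
move=> k0 kB tr mu1 mu2 M1 M2 pi1 pi2 S h1 h2 m1 m2 p1 p2 sub mt.
by apply: (tr _ _ _ _ _ _ _ _ m1 m2 p1 p2); exact: matched_weaken mt.
Qed.

Lemma transfers_equal V t1 t2 :
  (forall j, j \in term_vars t1 ++ term_vars t2 -> (j < V)%N) ->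
  transfers V (Equal t1 t2) 1 (size (term_vars t1) + size (term_vars t2)).+1.
Proof.
move=> tV mu1 mu2 M1 M2 pi1 pi2 h1 h2 mu1P mu2P pi1P pi2P.
case=> e [f [e0 f0 ag hP]] /=.
have ev t : {subset term_vars t <= term_vars t1 ++ term_vars t2} -> _ :=
  fun st => eval_matched pi1P pi2P e0 f0 (fun j jt => tV j (st j jt))
    (fun j jt => hP j (st j jt)).
have [|[E1 E2]|[E1 E2]] := ev t1; first by move=> j jt; rewrite mem_cat jt.
all: have [|[E3 E4]|[E3 E4]] := ev t2; try by move=> j jt; rewrite mem_cat jt orbT.
all: rewrite E1 E2 E3 E4 //.
- by split=> /esym /presents_eq0 => [/(_ _ pi1P)|/(_ _ pi2P)] /eqP;
  rewrite (negbTE (monomial_neq0 _ _ _)).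
- by split=> /presents_eq0 => [/(_ _ pi1P)|/(_ _ pi2P)] /eqP;
  rewrite (negbTE (monomial_neq0 _ _ _)).
rewrite (presents_eq_div _ pi1P) ?monomial_neq0 //.
rewrite (presents_eq_div _ pi2P) ?monomial_neq0 //.
rewrite -!exprN1 -!monomialX -!monomialD //.
rewrite -[monomial V e _]mulr1 -[monomial V f _]mulr1.
apply: (ag _ _ 1%N) => //.
move=> j; have := multiplicity_bound 1 t1 j; have := multiplicity_bound 1 t2 j.
lia.
Qed.

(** The bound on the variables must come before the exponent and the bound on
    relations: the monomials compared range over the first [V] variables, and
    subformulas have to be compared for a common [V]. *)
Definition transferable g := exists V0, forall V, (V0 <= V)%N ->
  exists N B, [/\ (0 < N)%N, (0 < B)%N & transfers V g N B].

Lemma transferable_binary g1 g2 g :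
  free_vars g = free_vars g1 ++ free_vars g2 ->
  (forall (M1 M2 : structure) (h1 : nat -> M1) (h2 : nat -> M2),
    (sat h1 g1 <-> sat h2 g1) -> (sat h1 g2 <-> sat h2 g2) ->
    (sat h1 g <-> sat h2 g)) ->
  transferable g1 -> transferable g2 -> transferable g.
Proof.
move=> fv sg [V1 tr1] [V2 tr2]; exists (maxn V1 V2) => V.
rewrite geq_max => /andP[/tr1 [N1 [B1 [N10 B10 t1]]] /tr2 [N2 [B2 [N20 B20 t2]]]].
exists (N1 * N2)%N, (B1 * N2 + B2 * N1)%N; split.
- by rewrite muln_gt0 N10.
- by rewrite addn_gt0 muln_gt0 B10 N20.
move=> mu1 mu2 M1 M2 pi1 pi2 h1 h2 m1 m2 p1 p2; rewrite fv => mt; apply: sg.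
- apply: (transfers_weaken N20 (leq_addr _ _) t1 m1 m2 p1 p2
      (S := free_vars g1 ++ free_vars g2)).
    by move=> j jt; rewrite mem_cat jt.
  by rewrite mulnC; exact: mt.
- apply: (transfers_weaken N10 (leq_addl _ _) t2 m1 m2 p1 p2
      (S := free_vars g1 ++ free_vars g2)).
    by move=> j jt; rewrite mem_cat jt orbT.
  exact: mt.
Qed.

(** The back-and-forth step: [matched_extend] is the forth half, and the back
    half is the same lemma with the two structures exchanged. *)
Lemma transferable_quantifier (x : nat) g1 g :
  free_vars g = [seq y <- free_vars g1 | y != x] ->
  (forall (M1 M2 : structure) (h1 : nat -> M1) (h2 : nat -> M2),
    (forall a, exists b, sat (update h1 x a) g1 <-> sat (update h2 x b) g1) ->
    (forall b, exists a, sat (update h1 x a) g1 <-> sat (update h2 x b) g1) ->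
    (sat h1 g <-> sat h2 g)) ->
  transferable g1 -> transferable g.
Proof.
  move=> fv sg [V1 tr1]; exists (maxn V1 x.+1) => V.
  rewrite geq_max => /andP[/tr1 [N [B [N0 B0 tr]]] xV].
  exists (B`! * N)%N, (extension_bound B); split.
  - by rewrite muln_gt0 fact_gt0.
  - by rewrite /extension_bound muln_gt0 fact_gt0 !addn_gt0 !muln_gt0 B0.
  move=> mu1 mu2 M1 M2 pi1 pi2 h1 h2 m1 m2 p1 p2; rewrite fv => mt.
  have sub j :
    j \in free_vars g1 -> j != x -> j \in [seq y <- free_vars g1 | y != x].
    by rewrite mem_filter => -> ->.
  apply: sg => [a|b].
    have [b mt'] := matched_extend a m1 m2 p1 p2 N0 B0 xV sub mt.
    by exists b; exact: (tr _ _ _ _ _ _ _ _ m1 m2 p1 p2 mt').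
  have [a mt'] := matched_extend b m2 m1 p2 p1 N0 B0 xV sub (matchedC mt).
  by exists a; exact: (tr _ _ _ _ _ _ _ _ m1 m2 p1 p2 (matchedC mt')).
Qed.

Lemma formula_transferable g : transferable g.
Proof.
elim: g => [t1 t2|g IH|g1 IH1 g2 IH2|g1 IH1 g2 IH2|g1 IH1 g2 IH2|x g IH|x g IH].
- exists (\max_(j <- term_vars t1 ++ term_vars t2) j).+1 => V VP.
  exists 1%N, (size (term_vars t1) + size (term_vars t2)).+1; split=> //.
  apply: transfers_equal => j jt; apply: leq_trans VP; rewrite ltnS.
  by rewrite (big_rem j) //= leq_maxl.
- have [V0 tr] := IH; exists V0 => V /tr [N [B [N0 B0 t]]].
  exists N, B; split=> // mu1 mu2 M1 M2 pi1 pi2 h1 h2 m1 m2 p1 p2 mt /=.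
  by have := t _ _ _ _ _ _ _ _ m1 m2 p1 p2 mt; tauto.
- by apply: transferable_binary IH1 IH2 => //= M1 M2 h1 h2; tauto.
- by apply: transferable_binary IH1 IH2 => //= M1 M2 h1 h2; tauto.
- by apply: transferable_binary IH1 IH2 => //= M1 M2 h1 h2; tauto.
- apply: transferable_quantifier IH => //= M1 M2 h1 h2 forth back; split=> H.
    by move=> b; have [a [ab _]] := back b; exact: ab.
  by move=> a; have [b [_ ba]] := forth a; exact: ba.
- apply: transferable_quantifier IH => //= M1 M2 h1 h2 forth back; split=> -[a Ha].
    by have [b [ab _]] := forth a; exists b; exact: ab.
  by have [b [_ ba]] := back a; exists b; exact: ba.
Qed.

Lemma trivial_subgroup : divisible_torsion_subgroup (fun x : F => x = 1).
Proof.
  split=> //.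
  - by move=> x y -> ->; rewrite mul1r.
  - by move=> x ->; rewrite invr1.
  - by move=> x ->; exists 1%N.
  - by move=> n x n0 ->; exists 1; rewrite ?expr1n.
Qed.

(** A sentence has no free variables, so the tuples consisting of ones match
    any two assignments as soon as the two groups contain the same roots of
    unity of small order. *)
Lemma holds_transfer g : sentence g -> exists B, forall mu (M1 M2 : structure)
    (pi1 : F -> M1) (pi2 : F -> M2), divisible_torsion_subgroup mu ->
  presents_quotient (fun x => x = 1) pi1 -> presents_quotient mu pi2 ->
  (forall z d, (0 < d <= B)%N -> z ^+ d = 1 -> mu z -> z = 1) ->
  holds M1 g -> holds M2 g.
Proof.
move=> sg; have [V tr] := formula_transferable g.
have [N [B [N0 B0 {}tr]]] := tr V (leqnn V); exists B.
move=> mu M1 M2 pi1 pi2 muP pi1P pi2P free Hg h2.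
apply: (iffLR (tr _ _ _ _ _ _ _ h2 trivial_subgroup muP pi1P pi2P _) (Hg (fun=> pi1 0))).
exists (fun=> 1), (fun=> 1); rewrite sg.
split=> // [j|j|m z d _ dB zd]; rewrite ?oner_neq0 //.
have -> : monomial V (fun=> 1) m = 1 by apply: big1 => j _; rewrite exp1rz.
rewrite mul1r; split=> [->|]; first exact: subgroup1.
exact: free dB zd.
Qed.

(** * Roots of unity of prime power order *)

Section PrimePower.
Variable p : nat.
Hypothesis p_pr : prime p.

Definition prime_power_root (x : F) : Prop := exists k, x ^+ (p ^ k) = 1.

Lemma prime_power_root_subgroup : divisible_torsion_subgroup prime_power_root.
Proof.
have p0 := prime_gt0 p_pr; split.
- by exists 0%N; rewrite expr1n.
- move=> x y [k xk] [l yl]; exists (k + l)%N; rewrite exprMn expnD.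
  by rewrite exprM xk [(p ^ k * _)%N]mulnC exprM yl !expr1n mulr1.
- by move=> x [k xk]; exists k; rewrite exprVn xk invr1.
- by move=> x [k xk]; exists (p ^ k)%N; rewrite // expn_gt0 p0.
move=> n x n0 [k xk].
(* Any root of order p^a of x is again of p-power order; on elements of
   p-power order, taking b-th roots for b prime to p is raising to a power. *)
have [b pb nE] := pfactor_coprime p_pr n0; set a := logn p n in nE.
have pa0 : (0 < p ^ a)%N by rewrite expn_gt0 p0.
pose y := (p ^ a).-root x.
have ya : y ^+ (p ^ a) = x by exact: rootCK.
have yP : y ^+ (p ^ (a + k)) = 1 by rewrite expnD exprM ya.
have b0 : (0 < b)%N by move: n0; rewrite nE muln_gt0 => /andP[].
have [u v uv _] := egcdnP (p ^ (a + k)) b0.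
exists (y ^+ u).
  by exists (a + k)%N; rewrite -exprM mulnC exprM yP expr1n.
have bP : gcdn b (p ^ (a + k)) = 1%N.
  by apply/eqP; rewrite -/(coprime _ _) coprimeXr // coprime_sym.
rewrite -exprM nE mulnA uv bP addn1 mulSn exprD ya.
by rewrite mulnAC [(v * _ * _)%N]mulnC exprM yP expr1n mulr1.
Qed.

Lemma prime_power_root_small z d : (0 < d < p)%N -> z ^+ d = 1 ->
  prime_power_root z -> z = 1.
Proof.
move=> /andP[d0 dp] zd [k zk].
have [u v uv _] := egcdnP (p ^ k) d0.
have dP : gcdn d (p ^ k) = 1%N.
  by apply/eqP; rewrite -/(coprime _ _) coprimeXr // coprime_sym
    prime_coprime // gtnNdvd.
have : z ^+ (u * d) = 1 by rewrite mulnC exprM zd expr1n.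
by rewrite uv dP addn1 exprS [(v * _)%N]mulnC exprM zk expr1n mulr1.
Qed.

Lemma exists_prime_root : exists2 z : F, z != 1 & z ^+ p = 1.
Proof.
(* A root of 1 + X + ... + X^(p-1) is a p-th root of unity, and it is not 1
   because p is nonzero in F. *)
pose P : {poly F} := \poly_(i < p) 1.
have sP : size P = p.
  by rewrite size_poly_eq // oner_neq0.
have /closed_rootP [z /rootP rz] : size P != 1%N.
  by rewrite sP neq_ltn prime_gt1 ?orbT.
have rE : \sum_(i < p) z ^+ i = 0.
  by rewrite -[RHS]rz /P horner_poly; apply: eq_bigr => i _; rewrite mul1r.
exists z; last by apply/eqP; rewrite -subr_eq0 subrX1 rE mulr0.
apply/eqP => z1; move/eqP: rE; rewrite z1.
under eq_bigr do rewrite expr1n.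
by rewrite sumr_const card_ord pnatr_eq0 -leqn0 leqNgt prime_gt0.
Qed.
End PrimePower.

(** * The quotient structure *)

Section Quotient.
Local Open Scope quotient_scope.
Variable mu : F -> Prop.
Hypothesis muP : divisible_torsion_subgroup mu.

Definition associate : rel F := fun x y => `[< exists2 w, mu w & x = w * y >].

Lemma associate_refl : reflexive associate.
Proof.
by move=> x; apply/asboolP; exists 1; [exact: subgroup1 | rewrite mul1r].
Qed.

Lemma associate_sym : symmetric associate.
Proof.
have H x y : associate x y -> associate y x.
  move=> /asboolP[w muw ->]; apply/asboolP; exists w^-1; first exact: subgroupV.
  by rewrite mulKf // (subgroup_neq0 muP).
by move=> x y; apply/idP/idP; exact: H.
Qed.

Lemma associate_trans : transitive associate.
Proof.
move=> y x z /asboolP[w muw ->] /asboolP[u muu ->]; apply/asboolP.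
by exists (w * u); [exact: subgroupM | rewrite mulrA].
Qed.

Canonical associate_equiv :=
  EquivRel associate associate_refl associate_sym associate_trans.

Definition associate_class : F -> {eq_quot associate} :=
  \pi_({eq_quot associate}).

Definition quotient : structure := @Structure {eq_quot associate}
  (fun a b => associate_class (repr a * repr b)) (inhabits (associate_class 0)).

Lemma quotient_presents :
  presents_quotient mu (associate_class : F -> quotient).
Proof.
have E (x y : F) :
    associate_class x = associate_class y <-> exists2 w, mu w & x = w * y.
  by split=> [/eqquotP /asboolP //|H]; exact/eqquotP/asboolP.
have reprE x : exists2 w, mu w & x = w * repr (associate_class x).
  by apply/E; rewrite /associate_class reprK.
split=> //.
- by move=> a; exists (repr a); rewrite /associate_class reprK.
- move=> x y /=; apply/E.
  have [w muw xE] := reprE x; have [u muu yE] := reprE y.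
  by exists (w * u); [exact: subgroupM | rewrite {1}xE {1}yE mulrACA].
Qed.
End Quotient.

(** * A sentence about roots of unity *)

(** There are a neutral element [u] and some [x] distinct from [u] with
    [x^p u = u]; the constant 1 is not in the language, and the trailing factor
    [u] spares a special case for the empty product. *)
Definition root_of_unity_sentence p : formula :=
  Exists 0 (And (Forall 2 (Equal (Times (Var 0) (Var 2)) (Var 2)))
    (Exists 1 (And (Not (Equal (Var 1) (Var 0)))
      (Equal (iter p (Times (Var 1)) (Var 0)) (Var 0))))).

Lemma root_of_unity_sentenceP p : sentence (root_of_unity_sentence p).
Proof.
rewrite /sentence /=.
have -> : term_vars (iter p (Times (Var 1)) (Var 0)) = rcons (nseq p 1%N) 0%N.
  by elim: p => //= p ->.
by elim: p.
Qed.

Lemma sat_root_of_unity mu (M : structure) (pi : F -> M) p :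
  divisible_torsion_subgroup mu -> presents_quotient mu pi ->
  holds M (root_of_unity_sentence p) <-> exists2 z, ~ mu z & mu (z ^+ p).
Proof.
move=> muP piP.
have evE (h : nat -> M) z : h 1%N = pi z -> h 0%N = pi 1 ->
    eval h (iter p (Times (Var 1)) (Var 0)) = pi (z ^+ p).
  by move=> h1 h0; elim: p => //= p ->; rewrite h1 -(presentsM piP) exprS.
have pi1 z : pi z = pi 1 <-> mu z.
  by rewrite (presents_eq_div _ piP) ?oner_neq0 // divr1.
split=> [/(_ (fun=> pi 0)) /= [a [unit_a [b [ba bp]]]]|[z nz zp] h /=].
  have [u uE] := presents_surj piP a; have [z zE] := presents_surj piP b.
  have aE : a = pi 1.
    by have := unit_a (pi 1); rewrite /update /= uE -(presentsM piP) mulr1.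
  exists z; first by move=> /pi1; rewrite -zE -aE.
  by apply/pi1; rewrite -(evE (update (update (fun=> pi 0) 0%N a) 1%N b) z zE aE) bp.
exists (pi 1); split=> [a|].
  by have [x ->] := presents_surj piP a; rewrite /update /= -(presentsM piP) mul1r.
exists (pi z); split; first by move/pi1.
by rewrite (evE _ z) //; exact/pi1.
Qed.

End Roots.

Theorem theorem2p4 (R : realType) :
  ~ finitely_axiomatizable (theory (complex_times R)).
Proof.
case=> A [finA sA conA].
have idP : presents_quotient (fun x => x = 1) (id : R[i] -> complex_times R).
  split=> // [a|x y]; first by exists a.
  by split=> [->|[w -> ->]]; [exists 1 |]; rewrite ?mul1r.
pose carries b g := forall mu (M : structure) (pi : R[i] -> M),
  divisible_torsion_subgroup mu -> presents_quotient mu pi ->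
  (forall z d, (0 < d <= b)%N -> z ^+ d = 1 -> mu z -> z = 1) ->
  holds (complex_times R) g -> holds M g.
have [B HB] : exists B, forall g, A g -> carries B g.
  have /choice [bound boundP] : forall g, exists b, A g -> carries b g.
    move=> g; have [/sA sg|nAg] := pselect (A g); last by exists 0%N.
    have [b tr] := holds_transfer R[i] sg; exists b => _ mu M pi muP piP free.
    exact: tr muP idP piP free.
  (* Classical choice turns the formulas into a type with decidable equality,
     over which finite sets are sequences. *)
  have [s sE] := iffLR (@finite_seqP {classic formula} A) finA.
  exists (\max_(g <- s) bound g) => g Ag mu M pi muP piP free.
  apply: (boundP _ Ag) muP piP _ => // z d /andP[d0 db]; apply: free.
  rewrite d0 (leq_trans db) //.
  have gs : g \in s by move: Ag; rewrite sE.
  by rewrite (@big_rem _ _ _ {classic formula} s g) //= leq_maxl.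
have [p Bp p_pr] := prime_above B.
have muP := @prime_power_root_subgroup R[i] p p_pr.
have piP := quotient_presents muP.
have [_ conP] : consequences A (root_of_unity_sentence p).
  rewrite conA; split; first exact: root_of_unity_sentenceP.
  apply: (iffRL (sat_root_of_unity p (trivial_subgroup _) idP)).
  by have [z /eqP z1 zp] := exists_prime_root R[i] p_pr; exists z.
have axioms_hold g : A g -> holds (quotient muP) g.
  move=> Ag; apply: (HB _ Ag) muP piP _ _ => [z d /andP[d0 dB]|].
    by apply: prime_power_root_small; rewrite // d0 (leq_ltn_trans dB).
  have : consequences A g by split=> [|M]; [exact: sA | apply].
  by rewrite conA => -[].
have [z nz [k zk]] := iffLR (sat_root_of_unity p muP piP) (conP _ axioms_hold).
by apply: nz; exists k.+1; rewrite expnS exprM.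
Qed.
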